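(* Let $F$ be admissible on $I=[0,a)$ with $a\in(0,\infty]$ such that $F\in C^{2,\sigma}((0,a))$ for some $\sigma\in[0,1)$, $\lim_{r\to+0}F(r)=-\infty$, and $F'>0$ in $(0,a)$ with $\liminf_{r\to+0}F'(r)>0$. Let $\Omega$ be a (non-empty) convex domain in $\mathbb{R}^n$. Assume that for any initial datum $\phi\in\mathcal{C}_\Omega[F]\cap C^{2,\sigma}(\Omega)\cap BC^1(\overline{\Omega})$ with $\phi\not\equiv0$ in $\Omega$, there exist $T\in(0,\infty]$ and a classical solution $u\in C^{2;1}(\Omega\times[0,T))$ of problem (N) (defined in the context) such that $u(\cdot,t)\in\mathcal{C}_\Omega[F]$ for all $t\in(0,T)$. Then, for any $\theta\in\mathbb{R}^n$ and $\ell\in\mathbb{R}$, the function $$\widetilde{\mathcal{H}}(x):=\frac{\mathcal{G}\big(x,0,f_F(\langle\theta,x\rangle+\ell),f_F'(\langle\theta,x\rangle+\ell)\theta\big)}{f_F'(\langle\theta,x\rangle+\ell)}+\frac{f_F''(\langle\theta,x\rangle+\ell)}{f_F'(\langle\theta,x\rangle+\ell)}\langle A(x,0)\theta,\theta\rangle$$ is concave in $\{x\in\Omega\mid\langle\theta,x\rangle+\ell\in J_F\}$, where $A(x,0):=(a^{ij}(x,0))$.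
   Context: **$F$-concavity.** $F:I\to[-\infty,\infty)$ is *admissible* on $I=[0,a)$ if $F$ is continuous on $(0,a)$, strictly increasing on $I$, and $F(0)=-\infty$. $J_F:=F((0,a))$, $f_F:J_F\to(0,a)$ is the inverse of $F|_{(0,a)}$. A function $f:\Omega\to\mathbb{R}$ with $f(\Omega)\subset I$ is *$F$-concave* in $\Omega$ if $F(f((1-\lambda)x+\lambda y))\ge(1-\lambda)F(f(x))+\lambda F(f(y))$ for all $x,y\in\Omega$, $\lambda\in(0,1)$, with the conventions $-\infty\le-\infty$, $-\infty+b=-\infty$ for $b\in[-\infty,\infty)$, $\kappa\cdot(-\infty)=-\infty$ for $\kappa>0$. $\mathcal{C}_\Omega[F]$ is the set of $F$-concave functions in $\Omega$. **Function spaces.** $C^{2,\sigma}$: twice continuously differentiable with second derivatives $\sigma$-Hölder continuous on compact subsets ($C^{2,0}=C^2$). $BC^1(\overline{\Omega})$: $C^1$ functions on $\overline{\Omega}$ that are bounded together with their first derivatives. $C^{2;1}(\Omega\times[0,T))$: functions $u$ with $u,\partial_{x_i}u,\partial_{x_i}\partial_{x_j}u,\partial_tu$ continuous on $\Omega\times[0,T)$. **Problem (N).** $$\begin{cases} \partial_t u=\sum_{i,j=1}^n a^{ij}(x,t)\partial_{x_i}\partial_{x_j}u+\mathcal{G}(x,t,u,\nabla u)&\text{in }\Omega\times(0,T),\\ u>0&\text{in }\Omega\times(0,T),\\ u=0&\text{on }\partial\Omega\times[0,T)\text{ if }\partial\Omega\neq\emptyset,\\ u(\cdot,0)=\phi\ge0&\text{in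 }\Omega, \end{cases}$$ where, on some time interval $[0,T_0)$, $T_0\in(0,\infty]$ (and $T\le T_0$), $a^{ij}$ are bounded and continuous on $\Omega\times[0,T_0)$, $A(x,t)=(a^{ij}(x,t))$ is symmetric and there is $\Lambda>0$ with $\Lambda^{-1}|\xi|^2\le\langle A(x,t)\xi,\xi\rangle\le\Lambda|\xi|^2$ for all $\xi\in\mathbb{R}^n$ and $(x,t)\in\Omega\times[0,T_0)$, and $\mathcal{G}\in C(\Omega\times[0,T_0)\times(0,\infty)\times\mathbb{R}^n)$. A *classical solution* is a function $u\in C((\overline{\Omega}\times(0,T))\cup(\Omega\times[0,T)))$ with $u\in C^{2;1}(\Omega\times(0,T))$ satisfying (N) pointwise (no continuity at $\partial\Omega\times\{0\}$ is required, so $\phi$ need not vanish on $\partial\Omega$). *)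

(* Defs.v *)
From HB Require Import structures.
From mathcomp Require Import all_boot all_order all_algebra.
From mathcomp Require Import all_classical all_reals all_analysis.

Set Implicit Arguments.
Unset Strict Implicit.
Unset Printing Implicit Defensive.

Import Order.TTheory GRing.Theory Num.Theory.
Import numFieldNormedType.Exports.

Local Open Scope ring_scope.
Local Open Scope classical_set_scope.

(* Points of R^n are row vectors 'rV[R]_n. Functions on a set (Omega, I,
   Omega x [0, T), etc.) are total functions of which only the values on that
   set matter. *)

Section Intervals.
Context {R : realType}.

(* (0, a) and [0, a), where a may be +oo. *)
Definition itv0oo (a : \bar R) : set R := [set r | 0 < r /\ (r%:E < a)%E].
Definition itv0co (a : \bar R) : set R := [set r | 0 <= r /\ (r%:E < a)%E].

End Intervals.

Section Euclidean.
Context {R : realType} {n : nat}.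

Definition dotp (u v : 'rV[R]_n) : R := \sum_i u 0 i * v 0 i.

(* <B xi, xi>; the vector B xi, written as a row, is xi *m B^T. *)
Definition quadf (B : 'M[R]_n) (xi : 'rV[R]_n) : R := dotp (xi *m B^T) xi.

(* 'e_i is the i-th vector of the canonical basis. *)
Definition partial (i : 'I_n) (f : 'rV[R]_n -> R) (x : 'rV[R]_n) : R :=
  'D_('e_i) f x.

Definition gradient (f : 'rV[R]_n -> R) (x : 'rV[R]_n) : 'rV[R]_n :=
  \row_i partial i f x.

End Euclidean.

Section FunctionSpaces.
Context {R : realType}.

(* For sigma = 0 the bound reads |g x - g y| <= C, since 0 `^ 0 = 1; this holds
   for every g continuous on U, so that C^{2,0} is C^2. *)
Definition loc_holder (V : normedModType R) (sigma : R) (U : set V)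
    (g : V -> R) : Prop :=
  forall K : set V, compact K -> K `<=` U ->
    exists C : R, forall x y, K x -> K y ->
      `|g x - g y| <= C * `|x - y| `^ sigma.

(* C^{2,sigma}(D) for an open set D of the real line. *)
Definition C2sigma_real (sigma : R) (D : set R) (f : R -> R) : Prop :=
  [/\ forall r, D r -> derivable f r 1,
      forall r, D r -> derivable f^`() r 1,
      {within D, continuous f^`(2)}
    & loc_holder (V := R^o) sigma D f^`(2)].

Context {n : nat}.
Implicit Types (Om : set 'rV[R]_n) (f : 'rV[R]_n -> R).

(* C^2(Om), for Om open. *)
Definition C2 Om f : Prop :=
  [/\ {within Om, continuous f},
      forall i x, Om x -> derivable f x 'e_i,
      forall i, {within Om, continuous (partial i f)},
      forall i j x, Om x -> derivable (partial i f) x 'e_j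
    & forall i j, {within Om, continuous (partial j (partial i f))}].

Definition C2sigma (sigma : R) Om f : Prop :=
  C2 Om f /\ forall i j, loc_holder sigma Om (partial j (partial i f)).

Definition bounded_continuous_on_closure Om f : Prop :=
  exists g : 'rV[R]_n -> R,
    [/\ {within closure Om, continuous g},
        [bounded g x | x in closure Om]
      & forall x, Om x -> g x = f x].

(* BC^1 of the closure of the open set Om: f and its first partial derivatives,
   defined in Om, extend to bounded continuous functions on the closure. *)
Definition BC1_closure Om f : Prop :=
  [/\ forall i x, Om x -> derivable f x 'e_i,
      bounded_continuous_on_closure Om f
    & forall i, bounded_continuous_on_closure Om (partial i f)].

(* C^{2;1}(Om x J), for J = (0, T) or J = [0, T). The time derivative ut is the
   limit of difference quotients at times in J, hence one-sided at t = 0 in the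
   second case. *)
Definition C21 Om (J : set R) (u : 'rV[R]_n -> R -> R) : Prop :=
  let cont (w : 'rV[R]_n -> R -> R) :=
    {within Om `*` J, continuous (fun z : 'rV[R]_n * R => w z.1 z.2)} in
  [/\ cont u,
      forall i, (forall x t, Om x -> J t -> derivable (u ^~ t) x 'e_i) /\
        cont (fun x t => partial i (u ^~ t) x),
      forall i j,
        (forall x t, Om x -> J t -> derivable (partial i (u ^~ t)) x 'e_j) /\
        cont (fun x t => partial j (partial i (u ^~ t)) x)
    & exists ut : 'rV[R]_n -> R -> R,
        (forall x t, Om x -> J t ->
           (u x s - u x t) / (s - t) @[s --> within J t^'] --> ut x t) /\
        cont ut].

End FunctionSpaces.

Section FConcavity.
Context {R : realType}.
Implicit Types (a : \bar R) (F : R -> \bar R).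

Definition admissible a F : Prop :=
  [/\ (0 < a)%E,
      forall r, itv0co a r -> (F r < +oo)%E,
      {within itv0oo a, continuous F},
      forall r s, itv0co a r -> itv0co a s -> r < s -> (F r < F s)%E
    & F 0 = -oo%E].

(* An admissible F is real-valued on (0, a), where it coincides with Freal. *)
Definition Freal F : R -> R := fun r => fine (F r).

Definition JF a F : set R := Freal F @` itv0oo a.

(* The inverse JF a F -> (0, a) of F. *)
Definition fF a F : R -> R := 'pinv_(fun=> 0) (itv0oo a) (Freal F).

(* The arithmetic of \bar R agrees with the conventions on -oo used here:
   -oo + b = -oo for b < +oo, and kappa%:E * -oo = -oo for 0 < kappa. *)
Definition Fconcave a F (n : nat) (Om : set 'rV[R]_n) (f : 'rV[R]_n -> R)
    : Prop :=
  (forall x, Om x -> itv0co a (f x)) /\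
  forall x y (lam : R), Om x -> Om y -> 0 < lam -> lam < 1 ->
    ((1 - lam)%:E * F (f x) + lam%:E * F (f y)
       <= F (f ((1 - lam) *: x + lam *: y)%R))%E.

End FConcavity.

Section Problem.
Context {R : realType} {n : nat}.
Implicit Types (Om : set 'rV[R]_n) (T : \bar R) (A : 'rV[R]_n -> R -> 'M[R]_n)
  (G : 'rV[R]_n -> R -> R -> 'rV[R]_n -> R).

(* A convex set is connected, so a convex domain is just a nonempty open convex
   set. *)
Definition convex_domain Om : Prop :=
  [/\ open Om, Om !=set0 & convex_set Om].

Definition concave_on (D : set 'rV[R]_n) (f : 'rV[R]_n -> R) : Prop :=
  convex_function D (fun x => - f x).

Definition elliptic_coefficients Om T A : Prop :=
  [/\ forall i j, [bounded A z.1 z.2 i j | z in Om `*` itv0co T],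
      forall i j, {within Om `*` itv0co T,
        continuous (fun z : 'rV[R]_n * R => A z.1 z.2 i j)},
      forall x t, Om x -> itv0co T t -> (A x t)^T = A x t
    & exists2 Lam : R, 0 < Lam &
        forall xi x t, Om x -> itv0co T t ->
          Lam^-1 * dotp xi xi <= quadf (A x t) xi <= Lam * dotp xi xi].

Definition continuous_nonlinearity Om T G : Prop :=
  {within [set z : 'rV[R]_n * R * R * 'rV[R]_n |
             [/\ Om z.1.1.1, itv0co T z.1.1.2 & 0 < z.1.2]],
     continuous (fun z => G z.1.1.1 z.1.1.2 z.1.2 z.2)}.

(* Continuity of u is required only on the union of closure Om x (0, T) and
   Om x [0, T), so the boundary condition at t = 0 does not constrain phi. *)
Definition classical_solution Om A G (phi : 'rV[R]_n -> R) T
    (u : 'rV[R]_n -> R -> R) : Prop :=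
  [/\ {within (closure Om `*` itv0oo T) `|` (Om `*` itv0co T),
         continuous (fun z : 'rV[R]_n * R => u z.1 z.2)}
      /\ C21 Om (itv0oo T) u,
      forall x t, Om x -> itv0oo T t ->
        (u x)^`() t =
          (\sum_i \sum_j A x t i j * partial i (partial j (u ^~ t)) x)
          + G x t (u x t) (gradient (u ^~ t) x),
      forall x t, Om x -> itv0oo T t -> 0 < u x t,
      forall x t, (closure Om `\` Om) x -> itv0co T t -> u x t = 0
    & forall x, Om x -> u x 0 = phi x /\ 0 <= phi x].

Definition Htilde (a : \bar R) (F : R -> \bar R) A G (theta : 'rV[R]_n)
    (l : R) (x : 'rV[R]_n) : R :=
  let f := fF a F in let f' := f^`() in let f'' := f^`(2) in
  let s := dotp theta x + l in
  G x 0 (f s) (f' s *: theta) / f' s + f'' s / f' s * quadf (A x 0) theta.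

End Problem.

(* Main.v *)
Require Import Defs.
From HB Require Import structures.
From mathcomp Require Import all_boot all_order all_algebra.
From mathcomp Require Import all_classical all_reals all_analysis.
From mathcomp Require Import ring lra.

Set Implicit Arguments.
Unset Strict Implicit.
Unset Printing Implicit Defensive.

Import Order.TTheory GRing.Theory Num.Theory.
Import numFieldNormedType.Exports.

Local Open Scope ring_scope.
Local Open Scope classical_set_scope.

(* Let g be a concave C^2 function equal to the identity on (-oo, c] and bounded
   above by some b in J_F, where c lies in J_F above the values of <theta, x> + l
   at the two given points. Then phi x = f_F (g (<theta, x> + l)) is an
   F-concave initial datum (f_F' = 1 / F' is bounded near -oo because
   liminf F' > 0) with F (phi x) affine near the segment between the two points.
   Along a solution, F (u (., t)) is concave for t > 0, with equality at t = 0 on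
   that segment, so its right time derivative at t = 0 is concave along the
   segment; by the equation this derivative is Htilde. *)

(** * Algebra of continuous, locally Hölder functions *)

Section Holder.
Context {R : realType} {V : normedModType R}.
Implicit Types (f g : V -> R) (s : R).

(** Continuity is recorded separately because for [s = 0] the Hölder bound only says that [f] is
    bounded on compact sets. For [s = 1] the class is that of the functions Lipschitz on compact
    sets. *)
Definition cont_holder s f := continuous f /\ loc_holder s setT f.

Lemma compact_norm_bound (W : normedModType R) (K : set W) : compact K ->
  exists2 M : R, 0 < M & forall x, K x -> `|x| < M.
Proof. by move/compact_bounded/ex_strict_bound_gt0 => [M M0 /= KM]; exists M. Qed.

Lemma continuous_norm_bound f (K : set V) : continuous f -> compact K ->
  exists2 M : R, 0 < M & forall x, K x -> `|f x| < M.
Proof.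
move=> cf cK; have := @continuous_compact _ _ f K (continuous_subspaceT cf) cK.
by move/compact_norm_bound => [M M0 KM]; exists M => // x Kx; apply: KM; exists x.
Qed.

Lemma lipschitz_cont_holder f (M : R) :
  (forall x y, `|f x - f y| <= M * `|x - y|) -> cont_holder 1 f.
Proof.
move=> H; split; last first.
  by move=> K _ _; exists M => x y _ _; rewrite powRr1.
move=> x; apply/cvgrPdist_lt => e e0.
near=> y; apply: (le_lt_trans (H _ _)).
apply: (@le_lt_trans _ _ ((`|M| + 1) * `|x - y|)).
  by rewrite ler_wpM2r// (le_trans (ler_norm M))// lerDl.
rewrite -ltr_pdivlMl ?ltr_wpDl//.
near: y; apply: cvgr_dist_lt; first exact: cvg_id.
by rewrite mulr_gt0 ?invr_gt0 ?ltr_wpDl.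
Unshelve. all: by end_near. Qed.

Lemma cont_holder_cst s (c : R) : 0 <= s -> cont_holder s (fun _ : V => c).
Proof.
move=> s0; split; first by move=> x; exact: cvg_cst.
by move=> K _ _; exists 0 => x y _ _; rewrite subrr normr0 mul0r.
Qed.

Lemma cont_holderD s f g : cont_holder s f -> cont_holder s g ->
  cont_holder s (f \+ g).
Proof.
move=> [cf hf] [cg hg]; split.
  by move=> x; apply: continuousD; [exact: cf|exact: cg].
move=> K cK KT; have [C HC] := hf K cK KT; have [D HD] := hg K cK KT.
exists (C + D) => x y Kx Ky /=; rewrite opprD addrACA mulrDl.
by rewrite (le_trans (ler_normD _ _))// lerD// (HC, HD).
Qed.

Lemma cont_holderM s f g : cont_holder s f -> cont_holder s g ->
  cont_holder s (f \* g).
Proof.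
move=> [cf hf] [cg hg]; split.
  by move=> x; apply: continuousM; [exact: cf|exact: cg].
move=> K cK KT; have [C HC] := hf K cK KT; have [D HD] := hg K cK KT.
have [Mf Mf0 HMf] := continuous_norm_bound cf cK.
have [Mg Mg0 HMg] := continuous_norm_bound cg cK.
exists (Mf * D + Mg * C) => x y Kx Ky /=.
have -> : f x * g x - f y * g y = f x * (g x - g y) + g y * (f x - f y) by ring.
rewrite (le_trans (ler_normD _ _))// !normrM mulrDl -!mulrA.
by apply: lerD; apply: ler_pM => //; rewrite ?(HC, HD)// ltW// (HMf, HMg).
Qed.

Lemma cont_holderV s f : (forall x, f x != 0) -> cont_holder s f ->
  cont_holder s (fun x => (f x)^-1).
Proof.
move=> f0 [cf hf].
have cV : continuous (fun x => (f x)^-1).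
  by move=> x; apply: cvgV => //; exact: cf.
split=> // K cK KT; have [C HC] := hf K cK KT.
have [M M0 HM] := continuous_norm_bound cV cK.
exists (M * M * C) => x y Kx Ky.
have -> : (f x)^-1 - (f y)^-1 = (f x)^-1 * (f y)^-1 * (f y - f x).
  by field; rewrite !f0.
rewrite !normrM distrC -!mulrA.
apply: ler_pM; rewrite ?mulr_ge0//; first by rewrite ltW// HM.
by apply: ler_pM => //; rewrite ?HC// ltW// HM.
Qed.

(** On a compact set inside the ball of radius [M], the distance [|x - y|] splits as
    [|x - y|^(1 - s) * |x - y|^s], and the first factor is at most [(2 M)^(1 - s)]. *)
Lemma cont_holder_le s f : 0 <= s -> s < 1 -> cont_holder 1 f -> cont_holder s f.
Proof.
move=> s0 s1 [cf hf]; split=> // K cK KT.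
have [C HC] := hf K cK KT; have [M M0 HM] := compact_norm_bound cK.
exists (`|C| * (2 * M) `^ (1 - s)) => x y Kx Ky.
have [->|xy] := eqVneq x y.
  by rewrite !subrr normr0 mulr_ge0// ?mulr_ge0// powR_ge0.
have xy0 : 0 < `|x - y| by rewrite normr_gt0 subr_eq0.
apply: (le_trans (HC _ _ Kx Ky)).
rewrite (_ : 1 = (1 - s) + s); last by rewrite subrK.
rewrite powRD ?gt_eqF ?subrK ?oner_eq0// mulrA ler_wpM2r ?powR_ge0//.
apply: (le_trans (ler_wpM2r (powR_ge0 _ _) (ler_norm C))); apply: ler_wpM2l => //.
apply: ge0_ler_powR; rewrite ?nnegrE ?subr_ge0 ?(ltW s1) ?mulr_ge0 ?(ltW M0)//.
apply: (le_trans (ler_normB _ _)); rewrite mulr2n mulrDl mul1r.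
by rewrite lerD// ltW// HM.
Qed.

(** The image of a compact set under [f] is a compact subset of [D], where [F] has a Hölder
    constant. A Lipschitz inner function costs only a constant factor, so the exponent [s]
    survives. *)
Lemma cont_holder_comp s (D : set R) (F : R -> R) f : 0 <= s ->
  (forall x, D (f x)) -> open D -> {within D, continuous F} ->
  loc_holder (V := R^o) s D F -> cont_holder 1 f -> cont_holder s (F \o f).
Proof.
move=> s0 Df oD cF hF [cf hf]; split.
  move=> x; apply: continuous_comp; first exact: cf.
  by move: cF; rewrite continuous_open_subspace//; apply; rewrite inE.
move=> K cK KT.
have cfK : compact (f @` K)
  by apply: continuous_compact => //; exact: continuous_subspaceT.
have fKD : f @` K `<=` D by move=> _ [x _ <-].
have [C HC] := hF _ cfK fKD; have [L HL] := hf K cK KT.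
exists (`|C| * `|L| `^ s) => x y Kx Ky /=.
apply: (le_trans (HC _ _ (imageP _ Kx) (imageP _ Ky))).
rewrite -mulrA -powRM//; apply: (le_trans (ler_wpM2r (powR_ge0 _ _) (ler_norm C))).
apply: ler_wpM2l => //; apply: ge0_ler_powR; rewrite ?nnegrE ?mulr_ge0//.
have := HL _ _ Kx Ky; rewrite powRr1// => /le_trans; apply.
by rewrite ler_wpM2r// ler_norm.
Qed.

End Holder.

Section HolderReal.
Context {R : realType}.
Implicit Types f : R -> R.

Lemma derivable_continuous f (x : R) : derivable f x 1 -> {for x, continuous f}.
Proof. by move=> /derivable1_diffP/differentiable_continuous. Qed.

Lemma cont_holder_C1 f (df : R -> R) :
  (forall x : R, is_derive x 1 f (df x)) -> continuous df -> cont_holder (V := R^o) 1 f.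
Proof.
move=> D cdf.
have cf : continuous f by move=> x; apply: derivable_continuous; case: (D x).
(* [K] need not be an interval, so the derivative is bounded on [[- M, M]], which also contains the
   intermediate points of the mean value theorem. *)
split=> // K cK _; have [M M0 HM] := compact_norm_bound cK.
have [L L0 HL] := continuous_norm_bound (V := R^o) cdf (@segment_compact _ (- M) M).
exists L.
wlog xy : / forall x y, K x -> K y -> x <= y -> `|f x - f y| <= L * `|x - y| `^ 1.
  apply=> x y Kx Ky xy.
  have [z zxy ->] : exists2 z, z \in `[x, y]%R & f x - f y = df z * (x - y).
    have [z zxy e] := MVT_segment xy (fun z _ => D z) (continuous_subspaceT cf).
    by exists z => //; rewrite -opprB e; ring.
  rewrite normrM powRr1// ler_wpM2r// ltW// HL//=.
  have := HM _ Kx; have := HM _ Ky; rewrite !ltr_norml !in_itv/=.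
  by move: zxy; rewrite in_itv/= => /andP[? ?] /andP[? ?] /andP[? ?]; lra.
move=> x y Kx Ky; case: (leP x y) => [|/ltW] h; first exact: xy.
by rewrite distrC (distrC x); exact: xy.
Qed.

Lemma cont_holder_max0 f : cont_holder (V := R^o) 1 f ->
  cont_holder (V := R^o) 1 (fun x => Num.max 0 (f x)).
Proof.
move=> [cf hf]; split.
  by move=> x; apply: continuous_max; [exact: cvg_cst|exact: cf].
move=> K cK KT; have [C HC] := hf K cK KT; exists C => x y Kx Ky.
apply: le_trans (HC _ _ Kx Ky).
have : f x - f y <= `|f x - f y| by exact: ler_norm.
have : f y - f x <= `|f x - f y| by rewrite distrC ler_norm.
rewrite ler_norml.
by case: (ltP 0 (f x)); case: (ltP 0 (f y)) => *; apply/andP; split; lra.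
Qed.

End HolderReal.

(** * A bounded-above concave modification of the identity *)

Section RealLine.
Context {R : realType}.
Implicit Types f g df : R -> R.

(** Away from [c] one branch is in force locally. At [c] both difference quotients tend to the same
    limit, so it does not matter which of them each increment selects. *)
Lemma is_derive_glue f1 f2 d1 d2 (c : R) :
  (forall s, s <= c -> is_derive s 1 f1 (d1 s)) ->
  (forall s, c <= s -> is_derive s 1 f2 (d2 s)) ->
  f1 c = f2 c -> d1 c = d2 c ->
  forall s : R, is_derive s 1 (fun s => if s <= c then f1 s else f2 s)
                              (if s <= c then d1 s else d2 s).
Proof.
move=> D1 D2 fc dc s; case: (ltgtP s c) => sc.
- apply: (near_eq_is_derive _ (D1 s (ltW sc))).
  by near=> z; rewrite ifT// ltW//; near: z; exact: lt_nbhsl.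
- apply: (near_eq_is_derive _ (D2 s (ltW sc))).
  by near=> z; rewrite ifF//; apply/negbTE; rewrite -ltNge; near: z; exact: lt_nbhsr.
rewrite {}sc; have [d1c e1] := D1 c (lexx c); have [d2c e2] := D2 c (lexx c).
have E (h : R) : h^-1 *: ((if h *: 1 + c <= c then f1 (h *: 1 + c)
      else f2 (h *: 1 + c)) - (if c <= c then f1 c else f2 c)) =
    if h *: 1 + c <= c then h^-1 *: (f1 (h *: 1 + c) - f1 c) else
    h^-1 *: (f2 (h *: 1 + c) - f2 c).
  by rewrite lexx; case: ifP; rewrite // fc.
have L : h^-1 *: ((if h *: 1 + c <= c then f1 (h *: 1 + c)
      else f2 (h *: 1 + c)) - (if c <= c then f1 c else f2 c)) @[h --> 0^'] --> d1 c.
  under eq_fun do rewrite E.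
  move: d1c; rewrite /derivable => /cvgP; rewrite -/(derive f1 c 1) e1 => d1c.
  move: d2c; rewrite /derivable => /cvgP; rewrite -/(derive f2 c 1) e2 -dc => d2c.
  apply/cvgrPdist_lt => e e0.
  move/cvgrPdist_lt : d1c => /(_ e e0) d1c.
  move/cvgrPdist_lt : d2c => /(_ e e0) d2c.
  by near=> h; case: ifP => _; near: h.
split; first by apply/cvg_ex; exists (d1 c).
by apply/cvg_lim.
Unshelve. all: by end_near. Qed.

(** By the mean value theorem the slope between [s] and [t] is [dg c] for some intermediate [c];
    monotonicity compares it with [dg t]. This is the form in which concavity of [g] is used. *)
Lemma tangent_upper_bound (g dg : R -> R) :
  (forall s : R, is_derive s 1 g (dg s)) -> {homo dg : s t / s <= t >-> t <= s} ->
  forall s t, g s <= g t + dg t * (s - t).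
Proof.
move=> D dg_dec s t.
have cg x y : {within `[x, y], continuous g}.
  apply: continuous_subspaceT => z; apply: differentiable_continuous.
  by apply/derivable1_diffP; case: (D z).
case: (leP s t) => st.
- have [c cst e] := MVT_segment st (fun x _ => D x) (cg s t).
  have : dg t <= dg c by apply: dg_dec; case/andP : cst.
  have : 0 <= t - s by rewrite subr_ge0.
  by move=> *; nra.
- have [c cst e] := MVT_segment (ltW st) (fun x _ => D x) (cg t s).
  have : dg c <= dg t by apply: dg_dec; case/andP : cst.
  have : 0 <= s - t by rewrite subr_ge0 ltW.
  by move=> *; nra.
Qed.

(* Take g s = c + e atan ((s - c) / e) for s > c, with e = (b - c) / pi. *)
Lemma saturation (c b : R) : c < b ->
  exists g dg ddg : R -> R,
    [/\ forall s : R, is_derive s 1 g (dg s),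
        forall s : R, is_derive s 1 dg (ddg s),
        cont_holder (V := R^o) 1 ddg,
        forall s, s <= c -> g s = s
      & [/\ forall s, g s <= b,
        forall s, 0 <= dg s <= 1
      & forall s t, g s <= g t + dg t * (s - t)]].
Proof.
move=> cb.
pose e := (b - c) / pi.
have e0 : 0 < e by rewrite divr_gt0 ?subr_gt0// pi_gt0.
pose t s := (s - c) / e.
have Dt (s : R) : is_derive s 1 t e^-1.
  by rewrite /t; apply: is_derive_eq; rewrite scaler0 add0r subr0 [LHS]mulr1.
have tc : t c = 0 by rewrite /t subrr mul0r.
have t0 s : c <= s -> 0 <= t s.
  by move=> cs; rewrite divr_ge0 ?subr_ge0// ltW.
have p1 x : 0 < 1 + x ^+ 2 :> R by rewrite ltr_pwDl// sqr_ge0.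
(* [q (t s)] is the derivative of [(1 + t s ^+ 2)^-1]. It vanishes at [s = c], so the second
   derivatives match there too. *)
pose q x : R := - 2 * x * (1 + x ^+ 2)^-1 * (1 + x ^+ 2)^-1 * e^-1.
pose dg s := if s <= c then 1 else (1 + (t s) ^+ 2)^-1.
have Dg : forall s : R, is_derive s 1
   (fun s => if s <= c then s else c + e * atan (t s)) (dg s).
  apply: is_derive_glue.
  - move=> s _; have D := is_derive1_comp (is_derive1_atan (t s)) (Dt s).
    apply: is_derive_eq.
    by rewrite /GRing.scale/=; field; rewrite !gt_eqF.
  - by rewrite tc atan0 mulr0 addr0.
  - by rewrite tc expr0n addr0 invr1.
have Ddg : forall s : R, is_derive s 1 dg (if s <= c then 0 else q (t s)).
  apply: is_derive_glue.
  - move=> s _; have D : is_derive s 1 (fun s => 1 + t s ^+ 2) (2 * t s * e^-1).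
      apply: is_derive_eq; by rewrite /GRing.scale/=; ring.
    have tn : 1 + t s ^+ 2 != 0 by rewrite gt_eqF.
    apply: (is_derive_eq (@is_deriveV _ (fun s => 1 + t s ^+ 2) _ _ _ tn D)).
    by rewrite /q /GRing.scale/=; field; rewrite tn gt_eqF.
  - by rewrite tc expr0n addr0 invr1.
  - by rewrite tc /q mulr0 !mul0r.
(* Since [q 0 = 0] and [t s <= 0] for [s <= c], the case distinction can be moved inside [q]. The
   second derivative becomes an algebraic expression in the locally Lipschitz function
   [max 0 (t s)]. *)
have qE s : (if s <= c then 0 else q (t s)) = q (Num.max 0 (t s)).
  case: (leP s c) => sc.
    rewrite max_l; first by rewrite /q mulr0 !mul0r.
    by rewrite /t mulr_le0_ge0 ?subr_le0// invr_ge0 ltW.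
  by rewrite max_r// t0 ?ltW.
exists (fun s => if s <= c then s else c + e * atan (t s)), dg,
  (fun s => if s <= c then 0 else q (t s)); split=> //; last split.
- rewrite (funext qE).
  pose m s := Num.max 0 (t s).
  have H : cont_holder (V := R^o) 1 m.
    apply: cont_holder_max0; apply: cont_holder_C1 Dt _.
    by move=> x; exact: cvg_cst.
  have H2 : cont_holder (V := R^o) 1 (fun s => (1 + m s ^+ 2)^-1).
    apply: cont_holderV => [x|]; first by rewrite gt_eqF.
    apply: (@cont_holderD _ R^o 1 (fun=> 1)); first exact: cont_holder_cst.
    by apply: (@cont_holderM _ R^o 1 m m).
  apply: (@cont_holderM _ R^o 1 _ (fun=> e^-1)); last exact: cont_holder_cst.
  apply: (@cont_holderM _ R^o 1 _ (fun s => (1 + m s ^+ 2)^-1)) => //.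
  apply: (@cont_holderM _ R^o 1 _ (fun s => (1 + m s ^+ 2)^-1)) => //.
  by apply: (@cont_holderM _ R^o 1 (fun=> -2) m) => //; exact: cont_holder_cst.
- by move=> s ->.
- move=> s; case: (leP s c) => sc; first by rewrite (le_trans sc)// ltW.
  rewrite -lerBrDl -ler_pdivlMl// /e invf_div divfK ?subr_eq0 ?gt_eqF//.
  rewrite (le_trans (ltW (atan_ltpi2 _)))// ler_pdivrMr// mulr2n mulrDr mulr1.
  by rewrite lerDl pi_ge0.
- move=> s; rewrite /dg; case: ifP; rewrite ?ler01 ?lexx// => _.
  by rewrite invr_ge0 ltW//= invf_le1// lerDl sqr_ge0.
- apply: tangent_upper_bound Dg _ => x y xy; rewrite /dg.
  case: (leP y c) => yc; first by rewrite (le_trans xy yc).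
  case: (leP x c) => xc; first by rewrite invf_le1// lerDl sqr_ge0.
  rewrite lef_pV2 ?posrE// lerD2l ler_sqr ?nnegrE ?t0 ?(ltW xc) ?(ltW yc)//.
  by rewrite /t ler_wpM2r ?invr_ge0 ?(ltW e0)// lerD2r.
Qed.

End RealLine.

(** * The inverse of [F] and its truncation *)

Section Inverse.
Context {R : realType}.
Context (a : \bar R) (F : R -> \bar R) (sigma : R).
Context (F_adm : admissible a F).
Context (F_C2 : C2sigma_real sigma (itv0oo a) (Freal F)).
Context (F_lim0 : F r @[r --> 0^'+] --> -oo%E).
Context (F'_gt0 : forall r, itv0oo a r -> 0 < (Freal F)^`() r).
Context (F'_liminf :
  (0 < limf_einf (fun r : R => ((Freal F)^`() r)%classic%:E) 0^'+)%E).

Local Notation Fr := (Freal F).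
Local Notation dFr := (derive1 Fr).
Local Notation ddFr := (derive1n 2 Fr).
Local Notation f := (fF a F).
Local Notation D := (itv0oo a).
Local Notation J := (JF a F).

Lemma itv0oo_co r : D r -> itv0co a r.
Proof. by case=> r0 ra; split=> //; exact: ltW. Qed.

Lemma open_itv0oo : open D.
Proof.
case: a => [b| |].
- rewrite (_ : itv0oo _ = [set r : R | 0 < r] `&` [set r | r < b]).
    by apply: openI; [exact: open_gt|exact: open_lt].
  by apply/seteqP; split=> r [? ?]; split=> //; rewrite /= ?lte_fin// -lte_fin.
- rewrite (_ : itv0oo _ = [set r : R | 0 < r]); first exact: open_gt.
  by apply/seteqP; split=> r /=; [case|move=> ?; split=> //; exact: ltry].
- rewrite (_ : itv0oo _ = set0); first exact: open0.
  by apply/seteqP; split=> r //= [_]; rewrite ltNge leNye.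
Qed.

Lemma itv0oo_le r s : 0 < r -> r <= s -> D s -> D r.
Proof. by move=> r0 rs [_ sa]; split=> //; apply: le_lt_trans sa; rewrite lee_fin. Qed.

Lemma Freal_EFin r : D r -> (Fr r)%:E = F r.
Proof.
move=> Dr; rewrite /Freal fineK// fin_numE; case: F_adm => a0 Fy _ Finc F0.
have D0 : itv0co a 0 by split.
rewrite gt_eqF /=; last by rewrite -F0; apply: Finc => //; [exact: itv0oo_co|case: Dr].
by rewrite lt_eqF// Fy//; exact: itv0oo_co.
Qed.

Lemma Freal_lt r s : D r -> D s -> r < s -> Fr r < Fr s.
Proof.
move=> Dr Ds rs; rewrite -lte_fin !Freal_EFin//.
by case: F_adm => _ _ _ Finc _; apply: Finc => //; exact: itv0oo_co.
Qed.

Lemma fFP s : J s -> D (f s) /\ Fr (f s) = s.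
Proof.
move=> Js; split.
  by have := @surjpinv_image_sub _ _ (fun=> 0) _ _ Fr (fun x h => h); apply; exists s.
by rewrite /fF pinvK// inE.
Qed.

Lemma FrealK r : D r -> f (Fr r) = r.
Proof.
move=> Dr; rewrite /fF pinvKV ?inE// => x y; rewrite !inE => Dx Dy.
case: (ltgtP x y) => // [xy|yx] e.
- by have := Freal_lt Dx Dy xy; rewrite e ltxx.
- by have := Freal_lt Dy Dx yx; rewrite e ltxx.
Qed.

Lemma itv0oo_gt r : D r -> exists2 s, D s & r < s.
Proof.
case=> r0; case: a => [b| |].
- rewrite lte_fin => rb; exists ((r + b) / 2); last lra.
  by split; rewrite ?lte_fin; lra.
- by move=> _; exists (r + 1); [split; rewrite ?ltry//; lra|lra].
- by rewrite ltNge leNye.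
Qed.

Lemma JF_gt s : J s -> exists2 b, J b & s < b.
Proof.
case=> r Dr <-; have [t Dt rt] := itv0oo_gt Dr.
by exists (Fr t); [exists t|exact: Freal_lt].
Qed.

Lemma Freal_continuous r : D r -> {for r, continuous Fr}.
Proof. by move=> Dr; apply: derivable_continuous; case: F_C2 => + _ _ _; apply. Qed.

(** As [F] tends to [-oo] at [0], it takes a value below [t] at some small [e]; the intermediate
    value theorem on [[e, r]] then reaches [t]. *)
Lemma JF_le s t : J s -> t <= s -> J t.
Proof.
move=> [r Dr <-] tr; have r0 : 0 < r by case: Dr.
near (0 : R)^'+ => e.
have e0 : 0 < e by [].
have er : e < r by near: e; exact: nbhs_right_lt.
have et : Fr e <= t.
  rewrite -lee_fin Freal_EFin; last exact: itv0oo_le (ltW er) Dr.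
  by near: e; apply: cvgeNy_le.
have De x : e <= x -> x <= r -> D x.
  by move=> ex xr; apply: itv0oo_le Dr => //; exact: lt_le_trans ex.
have [||x] := @IVT _ Fr e r t (ltW er).
- apply: continuous_in_subspaceT => x; rewrite inE/= in_itv/= => /andP[ex xr].
  by apply: Freal_continuous; exact: De.
- by rewrite ge_min et/= le_max tr orbT.
by rewrite in_itv/= => /andP[ex xr] <-; exists x => //; exact: De.
Unshelve. all: by end_near. Qed.

Lemma near_itv0oo r : D r -> \forall t \near r, D t.
Proof. by move=> Dr; apply: open_nbhs_nbhs; split=> //; exact: open_itv0oo. Qed.

Lemma is_derive_Freal r : D r -> is_derive r 1 Fr (dFr r).
Proof.
by move=> Dr; rewrite derive1E; apply: derivableP; case: F_C2 => + _ _ _; apply.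
Qed.

Lemma is_derive_dFreal r : D r -> is_derive r 1 dFr (ddFr r).
Proof.
move=> Dr; rewrite derive1nS derive1n1 derive1E; apply: derivableP.
by case: F_C2 => _ + _ _; apply.
Qed.

Lemma is_derive_fF s : J s -> is_derive s 1 f (dFr (f s))^-1.
Proof.
move=> Js; have [Df Ffs] := fFP Js; rewrite -{1}Ffs.
apply: is_derive_inverse.
- by apply: filterS (near_itv0oo Df) => r; exact: FrealK.
- by apply: filterS (near_itv0oo Df) => r; exact: Freal_continuous.
- exact: is_derive_Freal.
- by rewrite gt_eqF// F'_gt0.
Qed.

(** The liminf gives a positive bound near [0], and on the remaining compact interval the continuous
    positive function [F'] attains its minimum. *)
Lemma F'_lower_bound r : D r ->
  exists2 m, 0 < m & forall s, 0 < s -> s <= r -> m <= dFr s.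
Proof.
move=> Dr; have r0 : 0 < r by case: Dr.
have : exists2 m, 0 < m & \forall s \near 0^'+, m <= dFr s.
  move: F'_liminf; rewrite limf_einfE => /ereal_sup_gt[_ [V NV <-]].
  have [p|p] := pselect (exists2 m : R, 0 < m & (m%:E <= ereal_inf
     [set (((Freal F)^`() x)%classic%:E)%E | x in V])%E).
    case: p => m m0 mi _; exists m => //; apply: filterS NV => x Vx.
    by rewrite -lee_fin; apply: (le_trans mi); apply: ereal_inf_lbound; exists x.
  (* The infimum is an extended real, whereas [m] has to be real: a finite infimum is used as it is,
     and [+oo] is replaced by [1]. *)
  move=> h; exfalso; apply: p; move: h; case: ereal_inf => [x| |] //=.
  - by rewrite lte_fin => x0; exists x.
  - by move=> _; exists 1 => //; rewrite leey.
case=> m m0 [e /= e0 He].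
have dist0 s : 0 < s -> s < e -> m <= dFr s.
  by move=> s0 se; apply: He => //=; rewrite sub0r normrN gtr0_norm.
have er : Num.min r (e / 2) <= r by rewrite ge_min lexx.
have [||c] := @EVT_min _ dFr (Num.min r (e / 2)) r => //.
  apply: continuous_in_subspaceT => x; rewrite inE/= in_itv/= => /andP[ex xr].
  apply: derivable_continuous; case: F_C2 => _ + _ _; apply.
  by apply: itv0oo_le Dr => //; apply: lt_le_trans ex; rewrite lt_min r0 divr_gt0.
rewrite in_itv/= => /andP[ec cr] Hc.
have F'c : 0 < dFr c.
  apply: F'_gt0; apply: itv0oo_le Dr => //; apply: lt_le_trans ec.
  by rewrite lt_min r0 divr_gt0.
exists (Num.min m (dFr c)); first by rewrite lt_min m0.
move=> s s0 sr; rewrite ge_min; case: (ltP s e) => se.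
  by rewrite dist0.
apply/orP; right; apply: Hc; rewrite in_itv/= sr andbT ge_min; apply/orP; right.
by apply: le_trans se; rewrite ler_pdivrMr// ler_peMr// ?ler1n// ltW.
Qed.

Context (sigma_ge0 : 0 <= sigma).
Context (sigma_lt1 : sigma < 1).

(** Take [h = f \o g] with [g] the saturation of the identity between [c] and some [b] in [J]. Then
    [F \o h = g] is concave, and [g <= b] keeps [h] in [(0, f b]], where [F' >= m > 0]; hence
    [dh = dg / F'(h)] lies between [0] and [1 / m]. *)
Lemma fF_truncation c : J c ->
  exists h dh ddh : R -> R,
  [/\ forall s : R, is_derive s 1 h (dh s),
      forall s : R, is_derive s 1 dh (ddh s),
      cont_holder (V := R^o) sigma ddh,
      forall s, s <= c -> h s = f s
    & [/\ forall s, D (h s),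
      exists M, forall s, `|h s| <= M /\ `|dh s| <= M
    & forall s t lam, 0 <= lam -> lam <= 1 ->
      (1 - lam) * Fr (h s) + lam * Fr (h t) <= Fr (h ((1 - lam) * s + lam * t)) ]].
Proof.
move=> Jc; have [b Jb cb] := JF_gt Jc.
have [g [dg [ddg [Dg Ddg Hddg gid [gb dg01 gtan]]]]] := saturation cb.
have Jg s : J (g s) by apply: JF_le Jb _.
pose h s := f (g s).
have Dh s : D (h s) by case: (fFP (Jg s)).
have Fh s : Fr (h s) = g s by case: (fFP (Jg s)).
pose p s := dFr (h s).
have p_neq0 s : p s != 0 by rewrite gt_eqF// F'_gt0.
pose dh s := dg s * (p s)^-1.
have is_dh (s : R) : is_derive s 1 h (dh s).
  have := is_derive1_comp (is_derive_fF (Jg s)) (Dg s).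
  by rewrite mulrC.
pose dp s := ddFr (h s) * dh s.
have is_dp (s : R) : is_derive s 1 p (dp s).
  exact: is_derive1_comp (is_derive_dFreal (Dh s)) (is_dh s).
pose ddh s := (ddg s - dg s * dp s * (p s)^-1) * (p s)^-1.
have is_ddh (s : R) : is_derive s 1 dh (ddh s).
  have D1 := is_deriveV (p_neq0 s) (is_dp s).
  apply: (is_derive_eq (@is_deriveM _ _ dg _ _ _ _ _ (Ddg s) D1)).
  by rewrite /ddh /GRing.scale/=; field.
(* Regularity is bootstrapped: [h] is C^1, hence locally Lipschitz, so [F'' \o h] is Hölder of
   exponent [sigma]; then [p = F' \o h] is C^1, so [dh = dg / p] is locally Lipschitz, and [ddh] is
   built from these by sums, products and inverses. *)
have c_dh : continuous dh by move=> s; apply: derivable_continuous; case: (is_ddh s).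
have H_h : cont_holder (V := R^o) 1 h by exact: cont_holder_C1 is_dh _.
have H_ddF : cont_holder (V := R^o) sigma (ddFr \o h).
  case: F_C2 => _ _ cF hF; apply: (@cont_holder_comp _ R^o sigma D) => //.
  exact: open_itv0oo.
have H_p : cont_holder (V := R^o) 1 p.
  apply: cont_holder_C1 is_dp _ => s; apply: cvgM; last exact: c_dh.
  by case: H_ddF => + _; apply.
have H_dg : cont_holder (V := R^o) 1 dg.
  by apply: cont_holder_C1 Ddg _; case: Hddg.
have H_Vp : cont_holder (V := R^o) 1 (fun s => (p s)^-1) by exact: cont_holderV.
have H_dh : cont_holder (V := R^o) 1 dh by exact: (@cont_holderM _ R^o 1 dg).
have lift q : cont_holder (V := R^o) 1 q -> cont_holder (V := R^o) sigma q.
  exact: cont_holder_le.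
have H_ddh : cont_holder (V := R^o) sigma ddh.
  apply: (@cont_holderM _ R^o sigma _ (fun s => (p s)^-1)); last exact: lift.
  rewrite (_ : (fun s => _) = ddg \+ (fun=> -1) \*
      (dg \* ((ddFr \o h) \* dh) \* (fun s => (p s)^-1))); last first.
    by apply/funext => s /=; rewrite mulN1r.
  apply: cont_holderD; first exact: lift.
  apply: cont_holderM; first exact: cont_holder_cst.
  apply: cont_holderM; last exact: lift.
  apply: cont_holderM; first exact: lift.
  by apply: cont_holderM => //; exact: lift.
have [Dfb Ffb] := fFP Jb.
have hb s : h s <= f b.
  by rewrite leNgt; apply/negP => /(Freal_lt Dfb (Dh s)); rewrite Ffb Fh ltNge gb.
have [m m0 Hm] := F'_lower_bound Dfb.
exists h, dh, ddh; split=> //; last split=> //.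
- by move=> s sc; rewrite /h gid.
- exists (Num.max (f b) m^-1) => s; have h0 : 0 < h s by case: (Dh s).
  split; first by rewrite gtr0_norm// le_max hb.
  have /andP[dg0 dg1] := dg01 s; have pm : m <= p s by exact: Hm.
  have p0 : 0 < p s by exact: lt_le_trans pm.
  rewrite le_max; apply/orP; right.
  have Vp0 : 0 <= (p s)^-1 by rewrite invr_ge0 ltW.
  rewrite ger0_norm ?mulr_ge0//; apply: (le_trans (ler_wpM2r Vp0 dg1)).
  by rewrite mul1r lef_pV2.
(* The tangent bound at the intermediate point [z] is averaged over [s] and [t]; the first-order
   terms cancel. *)
- move=> s t lam lam0 lam1; rewrite !Fh; set z := (1 - lam) * s + lam * t.
  have e1 : (1 - lam) * g s <= (1 - lam) * (g z + dg z * (s - z)).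
    by rewrite ler_wpM2l ?subr_ge0.
  have e2 : lam * g t <= lam * (g z + dg z * (t - z)) by rewrite ler_wpM2l.
  have e3 : (1 - lam) * (g z + dg z * (s - z)) + lam * (g z + dg z * (t - z)) = g z.
    by rewrite /z; ring.
  by rewrite -e3 lerD.
Qed.

End Inverse.

(** * Ridge functions: a function of one variable composed with an affine form *)

Section Ridge.
Context {R : realType} {n : nat}.
Implicit Types (th x v : 'rV[R]_n) (h : R -> R).

Lemma dotpD th x y : dotp th (x + y) = dotp th x + dotp th y.
Proof. by rewrite /dotp -big_split/=; apply: eq_bigr => i _; rewrite mxE mulrDr. Qed.

Lemma dotpZ th (k : R) x : dotp th (k *: x) = k * dotp th x.
Proof. by rewrite /dotp mulr_sumr; apply: eq_bigr => i _; rewrite mxE mulrCA. Qed.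

Lemma dotp_delta th i : dotp th 'e_i = th 0 i.
Proof.
rewrite /dotp (bigD1 i)//= mxE !eqxx mulr1 big1 ?addr0// => j ji.
by rewrite mxE eqxx (negbTE ji) mulr0.
Qed.

(** The norm of row vectors is the largest absolute value of an entry, so the constant is the sum of
    the [|th 0 i|]. *)
Lemma dotp_le th x : `|dotp th x| <= (\sum_i `|th 0 i|) * `|x|.
Proof.
rewrite /dotp (le_trans (ler_norm_sum _ _ _))// mulr_suml ler_sum// => i _.
rewrite normrM ler_wpM2l// [leRHS]/Num.norm /= mx_normrE.
by apply/bigmax_geP; right => /=; exists (0, i).
Qed.

Lemma cont_holder_dotp th (l : R) : cont_holder 1 (fun x => dotp th x + l).
Proof.
apply: (@lipschitz_cont_holder _ _ _ (\sum_i `|th 0 i|)) => x y.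
rewrite opprD addrACA subrr addr0 -mulN1r -dotpZ -dotpD scaleN1r.
exact: dotp_le.
Qed.

(** The difference quotient in direction [v] is literally that of [h] in direction [dotp th v]. *)
Lemma is_derive_ridge h (dh l : R) th x v : is_derive (dotp th x + l) 1 h dh ->
  is_derive x v (fun x => h (dotp th x + l)) (dh * dotp th v).
Proof.
move=> Dh.
pose c := dotp th v.
have D1 : is_derive (dotp th x + l) c h (dh * c).
  case: Dh => /derivable1_diffP d <-.
  split; first exact: diff_derivable.
  rewrite !deriveE//= -[X in 'd _ _ X = _]mulr1.
  by rewrite [LHS]linearZ mulrC.
have E : (fun t : R => t^-1 *:
    (((fun x => h (dotp th x + l)) \o shift x) (t *: v) - h (dotp th x + l))) =
  (fun t : R => t^-1 *:
    ((h \o shift (dotp th x + l)) (t *: c) - h (dotp th x + l))).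
  by apply/funext => t /=; rewrite dotpD dotpZ addrA.
case: D1; rewrite /derivable /derive -E => d1 d2.
by split.
Qed.

Section C2Ridge.
Context (sigma l : R) (th : 'rV[R]_n) (h dh ddh : R -> R).
Context (sigma_ge0 : 0 <= sigma).
Context (sigma_lt1 : sigma < 1).
Context (is_dh : forall s : R, is_derive s 1 h (dh s)).
Context (is_ddh : forall s : R, is_derive s 1 dh (ddh s)).
Context (H_ddh : cont_holder (V := R^o) sigma ddh).

Let phi x := h (dotp th x + l).

Lemma is_derive_ridge_delta i x : is_derive x 'e_i phi (dh (dotp th x + l) * th 0 i).
Proof.
rewrite -(dotp_delta th i); exact: is_derive_ridge.
Qed.

Lemma partial_ridge i : partial i phi = (fun x => dh (dotp th x + l) * th 0 i).
Proof. by apply/funext => x; rewrite /partial; case: (is_derive_ridge_delta i x). Qed.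

Lemma is_derive_partial_ridge i j x :
  is_derive x 'e_j (partial i phi) (ddh (dotp th x + l) * (th 0 i * th 0 j)).
Proof.
rewrite partial_ridge mulrA -(dotp_delta th j).
apply: (@is_derive_ridge (fun s => dh s * th 0 i)).
have D := is_ddh (dotp th x + l).
by apply: is_derive_eq; rewrite /GRing.scale/=; ring.
Qed.

Lemma partial2_ridge i j :
  partial j (partial i phi) = (fun x => ddh (dotp th x + l) * (th 0 i * th 0 j)).
Proof.
by apply/funext => x; rewrite {1}/partial; case: (is_derive_partial_ridge i j x).
Qed.

Let continuous_aff : continuous (fun x => dotp th x + l).
Proof. by case: (cont_holder_dotp th l). Qed.

Let continuous_phi : continuous phi.
Proof.
move=> x; apply: (@continuous_comp _ _ _ (fun x => dotp th x + l) h).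
  exact: continuous_aff.
by apply: derivable_continuous; case: (is_dh (dotp th x + l)).
Qed.

Let continuous_dphi i : continuous (partial i phi).
Proof.
rewrite partial_ridge => x.
apply: (@continuousM _ _ (fun x => dh (dotp th x + l)) (fun=> th 0 i)); last first.
  exact: cst_continuous.
apply: (@continuous_comp _ _ _ (fun x => dotp th x + l) dh).
  exact: continuous_aff.
by apply: derivable_continuous; case: (is_ddh (dotp th x + l)).
Qed.

Let cont_holder_ddphi i j : cont_holder sigma (partial j (partial i phi)).
Proof.
rewrite partial2_ridge.
apply: (@cont_holderM _ _ _ (fun x => ddh (dotp th x + l)) (fun=> _)).
  case: H_ddh => cd hd; apply: (@cont_holder_comp _ _ _ setT) => //.
  - exact: openT.
  - exact: continuous_subspaceT.
  - exact: cont_holder_dotp.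
exact: cont_holder_cst.
Qed.

Lemma C2sigma_ridge (Om : set 'rV[R]_n) : C2sigma sigma Om phi.
Proof.
split; first split.
- exact: continuous_subspaceT.
- by move=> i x _; case: (is_derive_ridge_delta i x).
- by move=> i; exact: continuous_subspaceT.
- by move=> i j x _; case: (is_derive_partial_ridge i j x).
- by move=> i j; apply: continuous_subspaceT; case: (cont_holder_ddphi i j).
by move=> i j K cK _; case: (cont_holder_ddphi i j) => _; apply.
Qed.

(** The ridge function and its partial derivatives live on the whole space, so they serve as their
    own extensions to the closure. *)
Lemma BC1_ridge (Om : set 'rV[R]_n) :
  (exists M, forall s, `|h s| <= M /\ `|dh s| <= M) -> BC1_closure Om phi.
Proof.
case=> M HM.
have bnd (g : 'rV[R]_n -> R) C : (forall x, `|g x| <= C) ->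
    [bounded g x | x in closure Om].
  move=> H; exists C; split; first by rewrite num_real.
  by move=> c Cc x _; apply: le_trans (ltW Cc).
split.
- by move=> i x _; case: (is_derive_ridge_delta i x).
- exists phi; split => //; first exact: continuous_subspaceT.
  by apply: (bnd _ M) => x; case: (HM (dotp th x + l)).
- move=> i; exists (partial i phi); split => //; first exact: continuous_subspaceT.
  apply: (bnd _ (M * `|th 0 i|)) => x; rewrite partial_ridge normrM ler_wpM2r//.
  by case: (HM (dotp th x + l)).
Qed.

End C2Ridge.
End Ridge.

(** * Limits along curves and one-sided difference quotients *)

Section Limits.
Context {R : realType}.

Lemma cvg_matrix (m n : nat) (T : Type) (Fi : set_system T) {FF : Filter Fi}
    (M : T -> 'M[R]_(m, n)) (L : 'M[R]_(m, n)) :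
  (forall i j, M t i j @[t --> Fi] --> L i j) -> M t @[t --> Fi] --> L.
Proof.
move=> H P [Q /= HQ QP].
have : \forall t \near Fi, forall i j, Q i j (M t i j).
  by apply: filter_forall => i; apply: filter_forall => j; apply: H; exact: HQ.
by apply: filterS => t Ht; apply: QP.
Qed.

Lemma cvg_sumr (I : finType) (T : Type) (Fi : set_system T) {FF : Filter Fi}
    (f : I -> T -> R) (l : I -> R) :
  (forall i, f i t @[t --> Fi] --> l i) ->
  \sum_i f i t @[t --> Fi] --> \sum_i l i.
Proof. by move=> H; apply: cvg_big => //; exact: add_continuous. Qed.

Lemma cvg_pair_nbhs (U V : topologicalType) (T : Type) (Fi : set_system T)
    {FF : Filter Fi} (f : T -> U) (g : T -> V) (a : U) (b : V) :
  f t @[t --> Fi] --> a -> g t @[t --> Fi] --> b ->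
  (f t, g t) @[t --> Fi] --> (a, b).
Proof. by move=> fa gb; exact: cvg_pair. Qed.

(** Relative continuity suffices along a curve that stays in [A]; it is applied to curves over a
    fixed [x] as the time decreases to [0]. *)
Lemma within_continuous_cvg (S W : topologicalType) (A : set S) (f : S -> W)
    (T : Type) (Fi : set_system T) {FF : Filter Fi} (c : T -> S) (z : S) :
  {within A, continuous f} -> A z -> c t @[t --> Fi] --> z ->
  (\forall t \near Fi, A (c t)) -> f (c t) @[t --> Fi] --> f z.
Proof.
move=> /subspace_continuousP cf Az cz Ac P /(cf z Az) /cz; rewrite /= !near_simpl => H.
by apply: filterS2 Ac H => t At; apply.
Qed.

Lemma near0_right_itv (T : \bar R) : (0 < T)%E ->
  \forall t \near 0^'+, itv0oo T t.
Proof.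
move=> T0; have H : \forall t \near (0 : R)^'+, (t%:E < T)%E.
  case: T T0 => [b| |] // b0; near=> t; last exact: ltry.
  by rewrite lte_fin; near: t; exact: nbhs_right_lt.
by near=> t; split; near: t => //; exact: nbhs_right_gt.
Unshelve. all: by end_near. Qed.

(** At an interior point of [J] the restriction to [J] disappears, and the shift [s = h + t] turns
    the quotient of [C21] into that of [derive1]. *)
Lemma difference_quotient_derive1 (f : R -> R) (J : set R) (t d : R) :
  nbhs t J -> (f s - f t) / (s - t) @[s --> within J t^'] --> d -> f^`() t = d.
Proof.
move=> Jt H; rewrite /derive1; apply/cvg_lim => //.
have E : (fun h : R => h^-1 *: (f (h + t) - f t)) =
    (fun h => (f (h + t) - f t) / ((h + t) - t)).
  by apply/funext => h; rewrite addrK /GRing.scale/= mulrC.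
rewrite E; apply: (cvg_comp (fun h => h + t) _ _ H) => P HP.
have {}HP : \forall s \near t, s != t -> P s.
  apply: filterS2 Jt HP => s Js.
  by move=> h1 h2; exact: h1.
have ct : h + t @[h --> 0] --> 0 + t by apply: cvgD; [exact: cvg_id|exact: cvg_cst].
rewrite add0r in ct.
have {}ct : \forall h \near (0 : R), h + t != t -> P (h + t) := ct _ HP.
change (\forall h \near (0 : R)^', P (h + t)); near=> h.
have : h + t != t -> P (h + t) by near: h; exact: cvg_within ct.
apply; rewrite -subr_eq0 addrK; near: h; exact: nbhs_dnbhs_neq.
Unshelve. all: by end_near. Qed.

Lemma cvg_right_difference_quotient (f : R -> R) (T : \bar R) (d : R) : (0 < T)%E ->
  (f s - f 0) / (s - 0) @[s --> within (itv0co T) 0^'] --> d ->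
  (f s - f 0) / s @[s --> 0^'+] --> d.
Proof.
move=> T0 H; under eq_fun do rewrite -[X in _ / X]subr0.
apply: (cvg_comp id _ _ H) => // P HP.
have {}HP : \forall s \near (0 : R), s != 0 -> itv0co T s -> P s := HP.
change (\forall s \near (0 : R)^'+, P s); near=> s.
have [s0 sT] : itv0oo T s by near: s; exact: near0_right_itv.
have : s != 0 -> itv0co T s -> P s by near: s; exact: cvg_within HP.
by apply; [rewrite gt_eqF|split=> //; exact: ltW].
Unshelve. all: by end_near. Qed.

(** A one-sided chain rule: the inner function has only a right derivative at [0]. Carathéodory's
    factorization of [F y - F (f 0)] by [y - f 0], with a factor continuous at [f 0], reduces it to
    a product of limits. *)
Lemma cvg_difference_quotient_comp (F f : R -> R) (dF d : R) :
  is_derive (f 0) 1 F dF -> (f s - f 0) / s @[s --> 0^'+] --> d ->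
  (F (f s) - F (f 0)) / s @[s --> 0^'+] --> dF * d.
Proof.
move=> /is_derive1_caratheodory[g [Fg cg <-]] H.
(* Right continuity at [0]: the increment of [f] is the convergent quotient times [s]. *)
have cf : f s @[s --> 0^'+] --> f 0.
  have h0 : (f s - f 0) / s * s @[s --> 0^'+] --> d * 0.
    by apply: cvgM => //; apply: cvg_within.
  have h1 : f 0 + (f s - f 0) / s * s @[s --> 0^'+] --> f 0 + d * 0.
    by apply: cvgD => //; exact: cvg_cst.
  rewrite mulr0 addr0 in h1; apply: cvg_trans h1; apply: near_eq_cvg; near=> s.
  by rewrite divfK ?gt_eqF// addrC subrK.
under eq_fun do rewrite Fg -mulrA.
by apply: cvgM => //; exact: cvg_comp cf cg.
Unshelve. all: by end_near. Qed.

End Limits.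

(** * The time derivative of a solution at the initial time *)

Section InitialTime.
Context {R : realType} {n : nat}.

Lemma near_eq_partial (f g : 'rV[R]_n -> R) (Om : set 'rV[R]_n) i x :
  open Om -> (forall y, Om y -> f y = g y) -> Om x -> partial i f x = partial i g x.
Proof.
move=> oOm fg Omx; apply: near_eq_derive.
by apply: filterS fg _; exact: open_nbhs_nbhs.
Qed.

(** The equation is only given for [t > 0], but both of its sides extend continuously to [t = 0] at
    a fixed [x] in [Om]. Positivity of [phi x] keeps the limit point in the set where [G] is
    continuous. *)
Lemma initial_time_derivative (Om : set 'rV[R]_n) (T0 T : \bar R)
    (A : 'rV[R]_n -> R -> 'M[R]_n) (G : 'rV[R]_n -> R -> R -> 'rV[R]_n -> R)
    (phi : 'rV[R]_n -> R) (u : 'rV[R]_n -> R -> R) (x : 'rV[R]_n) :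
  open Om -> elliptic_coefficients Om T0 A -> continuous_nonlinearity Om T0 G ->
  (0 < T)%E -> (T <= T0)%E -> classical_solution Om A G phi T u ->
  C21 Om (itv0co T) u -> Om x -> 0 < phi x ->
  (u x s - u x 0) / s @[s --> 0^'+] -->
    \sum_i \sum_j A x 0 i j * partial i (partial j phi) x
    + G x 0 (phi x) (gradient phi x).
Proof.
move=> oOm [_ cA _ _] cG T_gt0 TT0.
move=> [_ pde u_gt0 _ u0] [cu du ddu [ut [utP cut]]] Omx phix.
have J0 : itv0co T 0 by split.
have T0_gt0 : itv0co T0 0 by split=> //; exact: lt_le_trans TT0.
have JT0 t : itv0co T t -> itv0co T0 t.
  by case=> ? ?; split=> //; exact: lt_le_trans TT0.
have nearJ : \forall t \near (0 : R)^'+, itv0oo T t by exact: near0_right_itv.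
have Jo t : itv0oo T t -> itv0co T t by case=> t0 tT; split=> //; exact: ltW.
have cxt : (x, t) @[t --> (0 : R)^'+] --> (x, 0 : R).
  by apply: cvg_pair_nbhs; [exact: (@cvg_cst _ x)|apply: cvg_within].
have lim_at0 (w : 'rV[R]_n -> R -> R) (S : \bar R) :
    {within Om `*` itv0co S, continuous (fun z => w z.1 z.2)} -> itv0co S 0 ->
    (\forall t \near (0 : R)^'+, itv0co S t) ->
    w x t @[t --> 0^'+] --> w x 0.
  move=> cw S0 nS; apply: (within_continuous_cvg cw _ cxt) => //.
  by apply: filterS nS => t.
have nJ : \forall t \near (0 : R)^'+, itv0co T t by exact: filterS nearJ.
have nJ0 : \forall t \near (0 : R)^'+, itv0co T0 t by exact: filterS nJ.
(* The initial condition holds only in [Om]; as [Om] is open, it passes to the first and second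
   partial derivatives. *)
have u0E y : Om y -> u y 0 = phi y by move=> /u0[].
have p0E i y : Om y -> partial i (u^~ 0) y = partial i phi y.
  by move=> Omy; exact: (near_eq_partial i oOm u0E Omy).
have pp0E i j : partial i (partial j (u^~ 0)) x = partial i (partial j phi) x.
  by apply: (near_eq_partial i oOm _ Omx) => y; exact: p0E.
have lim_u : u x t @[t --> 0^'+] --> phi x by rewrite -u0E//; exact: lim_at0 cu _ _.
have lim_p i : partial i (u^~ t) x @[t --> 0^'+] --> partial i phi x.
  rewrite -p0E//; have [_ c] := du i.
  exact: (lim_at0 (fun y t => partial i (u^~ t) y)) c _ _.
have lim_pp i j : partial i (partial j (u^~ t)) x @[t --> 0^'+] -->
    partial i (partial j phi) x.
  rewrite -pp0E; have [_ c] := ddu j i.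
  exact: (lim_at0 (fun y t => partial i (partial j (u^~ t)) y)) c _ _.
have lim_rhs : \sum_i \sum_j A x t i j * partial i (partial j (u^~ t)) x
    + G x t (u x t) (gradient (u^~ t) x) @[t --> 0^'+] -->
    \sum_i \sum_j A x 0 i j * partial i (partial j phi) x
    + G x 0 (phi x) (gradient phi x).
  apply: cvgD.
    apply: cvg_sumr => i; apply: cvg_sumr => j; apply: cvgM; last exact: lim_pp.
    exact: (lim_at0 (fun y t => A y t i j)) (cA i j) _ _.
  have cc : (x, t, u x t, gradient (u^~ t) x) @[t --> 0^'+] -->
      (x, 0 : R, phi x, gradient phi x).
    apply: cvg_pair_nbhs; first exact: cvg_pair_nbhs.
    apply: cvg_matrix => i j; rewrite mxE; under eq_fun do rewrite mxE.
    exact: lim_p.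
  apply: (within_continuous_cvg cG _ cc) => //.
  near=> t; have Jt : itv0oo T t by near: t.
  by split=> //=; [exact/JT0/Jo|exact: u_gt0].
(* Positive times are interior to [[0, T)], so there the [ut] of [C21] is the derivative that occurs
   in the equation. *)
have utE t : itv0oo T t -> ut x t =
    \sum_i \sum_j A x t i j * partial i (partial j (u^~ t)) x
    + G x t (u x t) (gradient (u^~ t) x).
  move=> Jt; rewrite -pde//.
  apply/esym; apply: difference_quotient_derive1 (utP x t Omx (Jo t Jt)).
  apply: filterS Jo _; apply: open_nbhs_nbhs; split=> //; exact: open_itv0oo.
have lim_ut : ut x t @[t --> 0^'+] -->
    \sum_i \sum_j A x 0 i j * partial i (partial j phi) x
    + G x 0 (phi x) (gradient phi x).
  apply: cvg_trans lim_rhs; apply: near_eq_cvg.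
  by apply: filterS nearJ => t /utE.
(* Continuity of [ut] up to time [0] and uniqueness of limits identify [ut x 0]. *)
have <- : ut x 0 =
    \sum_i \sum_j A x 0 i j * partial i (partial j phi) x
    + G x 0 (phi x) (gradient phi x).
  by apply: cvg_unique lim_ut => //; exact: lim_at0 cut _ _.
exact: cvg_right_difference_quotient T_gt0 (utP x 0 Omx J0).
Unshelve. all: by end_near. Qed.
End InitialTime.

(** * Comparison of difference quotients along a segment *)

Theorem proposition4p4 (R : realType) (n : nat) (n_gt0 : (0 < n)%N)
  (* the function F *)
  (a : \bar R) (F : R -> \bar R) (sigma : R)
  (F_adm : admissible a F)
  (sigma_ge0 : 0 <= sigma) (sigma_lt1 : sigma < 1)
  (F_C2 : C2sigma_real sigma (itv0oo a) (Freal F))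
  (F_lim0 : F r @[r --> 0^'+] --> -oo%E)
  (F'_gt0 : forall r, itv0oo a r -> 0 < (Freal F)^`() r)
  (F'_liminf : (0 < limf_einf (fun r : R => ((Freal F)^`() r)%classic%:E) 0^'+)%E)
  (* the data of the problem *)
  (Om : set 'rV[R]_n) (Om_dom : convex_domain Om)
  (T0 : \bar R) (T0_gt0 : (0 < T0)%E)
  (A : 'rV[R]_n -> R -> 'M[R]_n) (A_ell : elliptic_coefficients Om T0 A)
  (G : 'rV[R]_n -> R -> R -> 'rV[R]_n -> R)
  (G_cont : continuous_nonlinearity Om T0 G)
  (* local-in-time solvability within F-concave functions *)
  (solvable : forall phi : 'rV[R]_n -> R,
     Fconcave a F Om phi -> C2sigma sigma Om phi -> BC1_closure Om phi ->
     (exists2 x, Om x & phi x <> 0) ->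
     exists (T : \bar R) (u : 'rV[R]_n -> R -> R),
       [/\ (0 < T)%E /\ (T <= T0)%E,
           classical_solution Om A G phi T u,
           C21 Om (itv0co T) u
         & forall t, itv0oo T t -> Fconcave a F Om (u ^~ t)]) :
  forall (theta : 'rV[R]_n) (l : R),
    concave_on [set x | Om x /\ JF a F (dotp theta x + l)]
      (Htilde a F A G theta l).
Proof.
move=> theta l t x0 x1; rewrite !inE => -[Om0 J0] [Om1 J1].
have [oOm _ cOm] := Om_dom.
(* The endpoints are set aside because F-concavity is stated for weights strictly between [0] and
   [1]. *)
have [->|t0] := eqVneq t 0%:i01; first by rewrite !conv0.
have [->|t1] := eqVneq t 1%:i01; first by rewrite !conv1.
(* [conv t x0 x1] gives the weight [t] to [x0], whereas [Fconcave] gives [lam] to its second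
   point. *)
pose lam : R := 1 - t%:num.
have lam1 : lam < 1 by rewrite gtrBl lt_neqAle eq_sym t0 ge0.
have lam0 : 0 < lam by rewrite subr_gt0 lt_neqAle t1 le1.
have lamE : t%:num = 1 - lam by rewrite /lam; ring.
set xl := conv t x0 x1.
have xlE : xl = (1 - lam) *: x0 + lam *: x1 by rewrite -lamE.
have Oml : Om xl.
  by have := cOm x0 x1 t; rewrite !inE; apply.
pose aff x := dotp theta x + l.
have affE x y : aff ((1 - lam) *: x + lam *: y) = (1 - lam) * aff x + lam * aff y.
  by rewrite /aff dotpD !dotpZ; ring.
(* [c] is chosen strictly above both values, so that [h] agrees with [f_F] on neighbourhoods of the
   values of [aff] on the segment and their derivatives agree there as well. *)
pose smax := Num.max (aff x0) (aff x1).
have Jmax : JF a F smax by rewrite /smax /Num.max; case: ifP.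
have [c Jc smaxc] := JF_gt F_adm Jmax.
have s0c : aff x0 < c by apply: le_lt_trans smaxc; rewrite le_max lexx.
have s1c : aff x1 < c by apply: le_lt_trans smaxc; rewrite le_max lexx orbT.
have slc : aff xl < c.
  have := ltr_pM2l lam0 (aff x1) c; rewrite s1c xlE affE.
  have l1 : 0 < 1 - lam by rewrite subr_gt0.
  by have := ltr_pM2l l1 (aff x0) c; rewrite s0c; lra.
have J_le s : s < c -> JF a F s.
  by move=> /ltW; exact: (JF_le F_adm F_C2 F_lim0 Jc).
have [h [dh [ddh [is_dh is_ddh H_ddh hE [Dh bnd_h conc_h]]]]] :=
  fF_truncation F_adm F_C2 F_lim0 F'_gt0 F'_liminf sigma_ge0 sigma_lt1 Jc.
pose phi x := h (aff x).
have phi_conc : Fconcave a F Om phi.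
  split; first by move=> x _; apply: itv0oo_co; exact: Dh.
  move=> x y mu _ _ mu0 mu1; rewrite -!(Freal_EFin F_adm (Dh _)).
  rewrite -!EFinM -EFinD lee_fin /phi.
  have -> : aff ((1 - mu) *: x + mu *: y) = (1 - mu) * aff x + mu * aff y.
    by rewrite /aff dotpD !dotpZ; ring.
  by apply: conc_h; exact: ltW.
have [||||T [u [[T_gt0 TT0] sol u21 u_conc]]] := solvable phi.
- exact: phi_conc.
- exact: C2sigma_ridge.
- exact: BC1_ridge.
- by exists x0 => //; apply/eqP; rewrite gt_eqF//; case: (Dh (aff x0)).
have u0E x : Om x -> u x 0 = phi x by case: sol => _ _ _ _ H /H[].
(* The chain rule multiplies the initial time derivative of [u] by [F'(phi x)], which is
   [1 / f_F'(aff x)]; this factor produces the two quotients in [Htilde]. *)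
have key x : Om x -> aff x < c ->
    (Freal F (u x s) - Freal F (u x 0)) / s @[s --> 0^'+] -->
    Htilde a F A G theta l x.
  move=> Omx xc.
  have Dphi : itv0oo a (phi x) by exact: Dh.
  have phi_gt0 : 0 < phi x by case: Dphi.
  have D := initial_time_derivative oOm A_ell G_cont T_gt0 TT0 sol u21 Omx phi_gt0.
  have DF : is_derive (u x 0) 1 (Freal F) (derive1 (Freal F) (phi x)).
    by rewrite u0E//; exact: (is_derive_Freal F_C2).
  have := cvg_difference_quotient_comp DF D.
  congr (_ --> _).
  have phiE : phi x = fF a F (aff x) by rewrite /phi hE// ltW.
  have Jx := J_le _ xc.
  have p_neq0 : derive1 (Freal F) (phi x) != 0 by rewrite gt_eqF// F'_gt0.
  have near_c z : z < c -> \near z, fF a F z = h z.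
    move=> zc; near=> y; rewrite hE//; apply: ltW; near: y; exact: lt_nbhsl.
  have E1 z : z < c -> derive1 (fF a F) z = dh z.
    move=> zc; rewrite derive1E (near_eq_derive _ (near_c z zc)).
    by case: (is_dh z).
  have E2 : derive1n 2 (fF a F) (aff x) = ddh (aff x).
    rewrite derive1nS derive1n1 derive1E.
    have := is_ddh (aff x) => -[_ <-]; apply: near_eq_derive.
    by near=> y; apply: E1; near: y; exact: lt_nbhsl.
  have dhE : dh (aff x) = (derive1 (Freal F) (phi x))^-1.
    rewrite -E1// derive1E phiE.
    by case: (is_derive_fF F_adm F_C2 F'_gt0 Jx).
  have gradE : gradient phi x = dh (aff x) *: theta.
    by apply/rowP => i; rewrite !mxE (partial_ridge l theta is_dh).
  have sumE : \sum_i \sum_j A x 0 i j * partial i (partial j phi) x =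
      ddh (aff x) * quadf (A x 0) theta.
    rewrite /quadf /dotp mulr_sumr; apply: eq_bigr => i _.
    rewrite mxE mulr_suml mulr_sumr; apply: eq_bigr => j _.
    by rewrite mxE (partial2_ridge l theta is_dh is_ddh)/=; ring.
  rewrite /Htilde -/(aff x) E1// E2 sumE gradE -phiE dhE.
  by rewrite invrK; ring.
have k0 := key x0 Om0 s0c; have k1 := key x1 Om1 s1c; have kl := key xl Oml slc.
pose v x s := Freal F (u x s).
(* Concavity is encoded as convexity of [- Htilde]; the concavity defect of [Htilde] will be the
   limit of nonnegative quantities. *)
suff : 0 <= Htilde a F A G theta l xl -
    ((1 - lam) * Htilde a F A G theta l x0 + lam * Htilde a F A G theta l x1).
  by rewrite convRE/= lamE /unstable.onem; lra.
have lim : (v xl s - v xl 0) / s - ((1 - lam) * ((v x0 s - v x0 0) / s) +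
      lam * ((v x1 s - v x1 0) / s)) @[s --> 0^'+] -->
    Htilde a F A G theta l xl -
    ((1 - lam) * Htilde a F A G theta l x0 + lam * Htilde a F A G theta l x1).
  apply: cvgB => //; apply: cvgD; apply: cvgM => //; exact: cvg_cst.
apply: (cvgr_to_ge lim); near=> s.
have Ts : itv0oo T s by near: s; exact: near0_right_itv.
have s_gt0 : 0 < s by case: Ts.
(* Positivity comes from the problem and the bound by [a] from F-concavity. Thus [F (u x s)] is
   finite and the inequality in the extended reals becomes one between reals. *)
have Du x : Om x -> itv0oo a (u x s).
  case: sol => _ _ u_gt0 _ _ Omx; have [H _] := u_conc s Ts.
  by have [_ ua] := H x Omx; split=> //; exact: u_gt0.
(* At time [0] there is equality, since [F (phi x) = aff x] at the three points. Subtracting it from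
   the inequality at time [s] leaves the defect at time [s], divided by [s]. *)
have v0 : v xl 0 = (1 - lam) * v x0 0 + lam * v x1 0.
  rewrite /v !u0E// /phi !hE ?(ltW slc) ?(ltW s0c) ?(ltW s1c)//.
  have Ff x : aff x < c -> Freal F (fF a F (aff x)) = aff x.
    by move=> /J_le/fFP[].
  by rewrite !Ff// xlE affE.
have vs : (1 - lam) * v x0 s + lam * v x1 s <= v xl s.
  have [_ H] := u_conc s Ts; have := H x0 x1 lam Om0 Om1 lam0 lam1.
  by rewrite -xlE -!(Freal_EFin F_adm (Du _ _))// -!EFinM -EFinD lee_fin.
rewrite v0.
have -> : (v xl s - ((1 - lam) * v x0 0 + lam * v x1 0)) / s -
  ((1 - lam) * ((v x0 s - v x0 0) / s) + lam * ((v x1 s - v x1 0) / s)) =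
  (v xl s - ((1 - lam) * v x0 s + lam * v x1 s)) / s by ring.
by rewrite divr_ge0 ?subr_ge0// ltW.
Unshelve. all: by end_near. Qed.
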